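(* Let $W\subset S^1$ with $|W|=4$ satisfy condition $T''(W)$: $(W+\tfrac i5)\cap W=\emptyset$ for $i=1,2,3,4$ (equivalently, the four elements of $W$ lie in distinct orbits of the rotation $x\mapsto x+\tfrac15$). Then either $P(W)$ holds, or $W\cong\{0,\tfrac14,\tfrac12,\tfrac34\}$.
   Context: Identify $S^1$ with $\mathbb{R}/\mathbb{Z}$. The group $O(2)$ acts on $S^1$ by translations $x\mapsto x+a$ and reflections $x\mapsto -x+2a$. A coloring $c:S^1\to\{R,B\}$ is distinguishing if no non-identity $\gamma\in O(2)$ satisfies $c\circ\gamma=c$. For $W\subset S^1$ with trivial pointwise stabilizer in $O(2)$, $P(W)$ holds if every precoloring $c:S^1\setminus W\to\{R,B\}$ extends to a distinguishing coloring of $S^1$. Write $W\cong W'$ if $W'=\gamma(W)$ for some $\gamma\in O(2)$. *)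

(* Defs.v *)
(* classical reals. S^1 = R/Z is modelled by R with equality mod 1. *)
From Stdlib Require Import Reals ZArith.
Open Scope R_scope.

Definition eq_mod1 (x y : R) : Prop := exists k : Z, x - y = IZR k.

(* A function on S^1 = a 1-periodic function on R. *)
Definition periodic (c : R -> bool) : Prop := forall x, c (x + 1) = c x.

Inductive O2 : Type :=
| Transl (a : R)
| Refl (a : R).

Definition act (g : O2) (x : R) : R :=
  match g with
  | Transl a => x + a
  | Refl a => - x + 2 * a
  end.

Definition is_id (g : O2) : Prop := forall x, eq_mod1 (act g x) x.

(* c : S^1 -> {R,B} (true = R, false = B) is distinguishing *)
Definition distinguishing (c : R -> bool) : Prop :=
  periodic c /\ forall g : O2, (forall x, c (act g x) = c x) -> is_id g.

(* P(W), W a (1-periodic) subset of R representing a subset of S^1 *)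
Definition P (W : R -> Prop) : Prop :=
  forall p : R -> bool, periodic p ->
    exists c : R -> bool, distinguishing c /\ (forall x, ~ W x -> c x = p x).

Definition fourset (w0 w1 w2 w3 : R) (x : R) : Prop :=
  eq_mod1 x w0 \/ eq_mod1 x w1 \/ eq_mod1 x w2 \/ eq_mod1 x w3.

Definition congruent (W W' : R -> Prop) : Prop :=
  exists g : O2, forall x, W' x <-> exists y, W y /\ eq_mod1 x (act g y).

(* Main.v *)
Require Import Defs.
From Stdlib Require Import Reals ZArith.
From Stdlib Require Import List Bool Lra Lia Classical.
Import ListNotations.
Local Open Scope R_scope.

(** Three points are scalene if no one of them is equidistant from the other two. The
    theorem reduces to: a scalene triple [w] satisfies [P]. Indeed four points all of
    whose triples are isosceles form a square or lie on a regular pentagon.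

    Given a precolouring, let [c_v] be its eight extensions to a scalene triple, [v]
    ranging over the sets of recoloured points, and suppose that each [c_v] has a
    symmetry. If [c_v] has a translation symmetry, it is symmetric about each point
    of the triple, and then no other [c_u] has a translation symmetry. Otherwise
    each [c_v] has exactly one reflection symmetry [x |-> b_v - x].

    In both cases we have reflections that preserve one colouring up to changes on the
    triple. Going around a closed walk composed of such reflections, the colour changes
    an even number of times. Most useful are the walks of length six given by
    [(abc)^2 = 1] for reflections [a], [b], [c]. Whether the walk meets the triple is a
    matter of linear congruences modulo 1 between the [w_i] and the [b_v], so that each
    walk asserts the parity of the number of valid congruences in some list. Finitely
    many of these assertions are contradictory, which a verified search by case
    analysis on the congruences establishes by computation. *)

(** * Equality on the circle *)

Lemma eq_mod1_refl x : eq_mod1 x x.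
Proof. exists 0%Z; lra. Qed.

Lemma eq_mod1_trans x y z : eq_mod1 x y -> eq_mod1 y z -> eq_mod1 x z.
Proof. intros [k H] [l H']; exists (k + l)%Z; rewrite plus_IZR; lra. Qed.

Lemma eq_mod1_shift a b x y : a - b = x - y -> eq_mod1 a b -> eq_mod1 x y.
Proof. intros E [k H]; exists k; lra. Qed.

Lemma eq_mod1_opp a b x y : a - b = y - x -> eq_mod1 a b -> eq_mod1 x y.
Proof. intros E [k H]; exists (- k)%Z; rewrite opp_IZR; lra. Qed.

Lemma eq_mod1_add a b a' b' x y :
  (a - b) + (a' - b') = x - y -> eq_mod1 a b -> eq_mod1 a' b' -> eq_mod1 x y.
Proof. intros E [k H] [l H']; exists (k + l)%Z; rewrite plus_IZR; lra. Qed.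

Lemma eq_mod1_scale k a b x y :
  IZR k * (a - b) = x - y -> eq_mod1 a b -> eq_mod1 x y.
Proof. intros E [l H]; exists (k * l)%Z; rewrite mult_IZR, <- H; lra. Qed.

(** A real number is an integer exactly when it equals its integer part, which makes the relation
    decidable. *)
Definition ceq (x y : R) : bool :=
  if Req_dec_T (x - y) (IZR (Int_part (x - y))) then true else false.

Lemma ceqP x y : ceq x y = true <-> eq_mod1 x y.
Proof.
  unfold ceq, eq_mod1; destruct (Req_dec_T _ _) as [E|E]; split; intros H; trivial.
  - now exists (Int_part (x - y)).
  - discriminate.
  - destruct H as [k Hk]. exfalso; apply E.
    rewrite Hk at 1. f_equal. rewrite Hk. apply Int_part_spec; lra.
Qed.

Lemma ceq_false x y : ~ eq_mod1 x y -> ceq x y = false.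
Proof. rewrite <- ceqP; apply not_true_is_false. Qed.

Lemma ceq_ext a b x y : (eq_mod1 a b <-> eq_mod1 x y) -> ceq a b = ceq x y.
Proof. intros H; apply eq_true_iff_eq; now rewrite !ceqP. Qed.

Lemma ceq_shift a b x y : a - b = x - y -> ceq a b = ceq x y.
Proof. intros E; apply ceq_ext; split; apply eq_mod1_shift; lra. Qed.

Lemma periodic_eq_mod1 f x y : periodic f -> eq_mod1 x y -> f x = f y.
Proof.
  intros Hf.
  assert (N : forall n z, f (z + INR n) = f z).
  { induction n as [|n IH]; intros z.
    - f_equal; simpl; lra.
    - rewrite S_INR, <- Rplus_assoc, Hf; apply IH. }
  intros [k H]. destruct (Z_le_dec 0 k) as [K|K].
  - rewrite <- (N (Z.to_nat k) y), INR_IZR_INZ, Z2Nat.id by easy.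
    f_equal; lra.
  - rewrite <- (N (Z.to_nat (- k)) x), INR_IZR_INZ, Z2Nat.id, opp_IZR by lia.
    f_equal; lra.
Qed.

(** * Linear forms modulo 1 *)

(** Omitted trailing coefficients are zero, and variables beyond the environment count as 0. *)
Definition form := list Z.

Fixpoint eval (env : list R) (e : form) {struct e} : R :=
  match e, env with
  | a :: e', x :: env' => IZR a * x + eval env' e'
  | _, _ => 0
  end.

Definition holds (env : list R) (e : form) : bool := ceq (eval env e) 0.

Fixpoint axpy (k : Z) (e e' : form) : form :=
  match e, e' with
  | a :: e1, b :: e1' => (k * a + b)%Z :: axpy k e1 e1'
  | [], _ => e'
  | _, [] => map (Z.mul k) e
  end.

Definition fadd (e e' : form) : form := axpy 1 e e'.
Definition fsub (e e' : form) : form := axpy (-1) e' e.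
Definition fopp (e : form) : form := map (Z.mul (-1)) e.
Definition fvar (j : nat) : form := repeat 0%Z j ++ [1%Z].

Lemma eval_hd_tl env e :
  eval env e = IZR (hd 0%Z e) * hd 0 env + eval (tl env) (tl e).
Proof.
  destruct e as [|a [|b e]], env as [|x [|y env]]; simpl; lra.
Qed.

Lemma eval_scale k e env : eval env (map (Z.mul k) e) = IZR k * eval env e.
Proof.
  revert env; induction e as [|a e IH]; intros [|x env]; simpl; try lra.
  rewrite IH, mult_IZR; lra.
Qed.

Lemma eval_axpy k e e' env :
  eval env (axpy k e e') = IZR k * eval env e + eval env e'.
Proof.
  revert e' env; induction e as [|a e IH]; intros [|b e'] env.
  - destruct env; simpl; lra.
  - destruct env; simpl; lra.
  - simpl axpy. rewrite (eval_scale k (a :: e)). destruct env; simpl; lra.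
  - destruct env as [|x env]; simpl; [lra|].
    rewrite IH, plus_IZR, mult_IZR; lra.
Qed.

Lemma eval_fadd e e' env : eval env (fadd e e') = eval env e + eval env e'.
Proof. unfold fadd; rewrite eval_axpy; lra. Qed.

Lemma eval_fsub e e' env : eval env (fsub e e') = eval env e - eval env e'.
Proof. unfold fsub; rewrite eval_axpy; lra. Qed.

Lemma eval_fopp e env : eval env (fopp e) = - eval env e.
Proof. unfold fopp; rewrite eval_scale; lra. Qed.

Lemma eval_fvar j env : eval env (fvar j) = nth j env 0.
Proof.
  revert env; induction j as [|j IH]; intros env; rewrite eval_hd_tl.
  - destruct env; simpl; lra.
  - change (tl (fvar (S j))) with (fvar j). rewrite IH; destruct env, j; simpl; lra.
Qed.

Lemma holds_fsub e e' env : holds env (fsub e e') = ceq (eval env e) (eval env e').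
Proof. unfold holds; apply ceq_shift; rewrite eval_fsub; lra. Qed.

(** * A refutation procedure for systems of congruences modulo 1 *)

(* A basis is in echelon form: the row stored at position [p] involves only the
   variables from [p] on, and is written without its [p] leading zeros. *)
Definition basis := list (option form).

Fixpoint sat (env : list R) (L : basis) : Prop :=
  match L with
  | [] => True
  | o :: L' =>
      match o with Some r => eq_mod1 (eval env r) 0 | None => True end /\
      sat (tl env) L'
  end.

(** Division with remainder by the pivots, as for a Hermite normal form. A positive pivot leaves a
    nonnegative remainder below it. *)
Fixpoint reduce (L : basis) (e : form) : form :=
  match L with
  | [] => e
  | None :: L' => hd 0%Z e :: reduce L' (tl e)
  | Some r :: L' =>
      let q := (hd 0 e / hd 0 r)%Z in
      if (q =? 0)%Z then hd 0%Z e :: reduce L' (tl e)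
      else (hd 0 e - q * hd 0 r)%Z :: reduce L' (axpy (- q) (tl r) (tl e))
  end.

Fixpoint euclid (fuel : nat) (e e' : form) : form * form :=
  match fuel with
  | O => (e, e')
  | S n =>
      if (hd 0 e' =? 0)%Z then (e, e')
      else euclid n e' (axpy (- (hd 0 e / hd 0 e'))%Z e' e)
  end.

Definition positive (e : form) : form :=
  if (hd 0 e <? 0)%Z then fopp e else e.

(** The Euclidean algorithm makes the gcd of the leading coefficients the new pivot and pushes the
    other row down. An equation is lost if fuel or positions run out, which only weakens the
    basis. *)
Fixpoint insert (L : basis) (e : form) : basis :=
  match L with
  | [] => []
  | o :: L' =>
      if (hd 0 e =? 0)%Z then o :: insert L' (tl e)
      else match o with
           | None => Some (positive e) :: L'
           | Some r =>
               let (r', e') := euclid 100 r e in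
               Some (positive r') ::
               (if (hd 0 e' =? 0)%Z then insert L' (tl e') else L')
           end
  end.

Fixpoint lex_le (e e' : form) : bool :=
  match e, e' with
  | a :: e1, b :: e1' =>
      match Z.compare a b with Lt => true | Gt => false | Eq => lex_le e1 e1' end
  | _, _ => true
  end.

(** A congruence and its negative are equivalent; the larger of their two remainders represents
    both. *)
Definition canon (L : basis) (e : form) : form :=
  let r := reduce L e in
  let s := reduce L (fopp e) in
  if lex_le r s then s else r.

Fixpoint is_zero (e : form) : bool :=
  match e with
  | [] => true
  | 0%Z :: e' => is_zero e'
  | _ => false
  end.

Fixpoint form_eqb (e e' : form) : bool :=
  match e, e' with
  | a :: e1, b :: e1' => if (a =? b)%Z then form_eqb e1 e1' else false
  | [], [] => true
  | _, _ => false
  end.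

Fixpoint mem (e : form) (l : list form) : bool :=
  match l with
  | [] => false
  | e' :: l' => if form_eqb e e' then true else mem e l'
  end.

Fixpoint toggle (e : form) (l : list form) : list form :=
  match l with
  | [] => [e]
  | e' :: l' => if form_eqb e e' then l' else e' :: toggle e l'
  end.

Definition nub (l : list form) : list form :=
  fold_right (fun e l => if mem e l then l else e :: l) [] l.

(** A conditional linear equation over the field with two elements, whose unknowns are the truth
    values of congruences. *)
Record clause := Clause { guards : list form; target : bool; atoms : list form }.

Definition parity (env : list R) (l : list form) : bool :=
  fold_right (fun e => xorb (holds env e)) false l.

Definition clause_ok (env : list R) (c : clause) : Prop :=
  forallb (holds env) (guards c) = true -> parity env (atoms c) = target c.

Inductive status := Yes | No | Unknown (e : form).

Fixpoint simp_guards (decide : form -> status) (gs : list form) : option (list form) :=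
  match gs with
  | [] => Some []
  | g :: gs' =>
      match decide g with
      | Yes => simp_guards decide gs'
      | No => None
      | Unknown e => option_map (cons e) (simp_guards decide gs')
      end
  end.

Fixpoint simp_atoms (decide : form -> status) (l : list form) : bool * list form :=
  match l with
  | [] => (false, [])
  | e :: l' =>
      let (b, r) := simp_atoms decide l' in
      match decide e with
      | Yes => (negb b, r)
      | No => (b, r)
      | Unknown e' => (b, toggle e' r)
      end
  end.

Definition simp_clause (decide : form -> status) (c : clause) : list clause :=
  match simp_guards decide (guards c) with
  | None => []
  | Some gs =>
      let (b, l) := simp_atoms decide (atoms c) in
      match xorb (target c) b, l with
      | false, [] => []
      | b', _ => [Clause gs b' l]
      end
  end.

Definition simp (decide : form -> status) : list clause -> list clause :=
  flat_map (simp_clause decide).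

Definition decide_by (L : basis) (N : list form) (e : form) : status :=
  let e := canon L e in
  if is_zero e then Yes else if mem e N then No else Unknown e.

(** A failed congruence does not alter the basis, so literals already in canonical form need only a
    syntactic comparison. *)
Definition decide_not (e e' : form) : status :=
  if form_eqb e e' then No else Unknown e'.

Definition violated (c : clause) : bool :=
  match c with Clause [] true [] => true | _ => false end.

Definition weight (c : clause) : nat :=
  2 * (length (guards c) + length (atoms c)) + (if target c then 0 else 1).

Fixpoint pick (best : option (nat * form)) (l : list clause) : option form :=
  match l with
  | [] => option_map snd best
  | c :: l' =>
      match guards c ++ atoms c with
      | [] => pick best l'
      | e :: _ =>
          let k := weight c in
          match best with
          | None => pick (Some (k, e)) l'
          | Some (k0, _) =>
              if Nat.ltb k k0 then pick (Some (k, e)) l' else pick best l'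
          end
      end
  end.

(* Case analysis on a literal of a lightest clause. A batch of [rest] is only
   brought in once the clauses [cur] are exhausted. *)
Fixpoint refute (fuel : nat) (L : basis) (N : list form)
    (cur : list clause) (rest : list (list clause)) : bool :=
  match fuel with
  | O => false
  | S n =>
      if existsb violated cur then true else
      match pick None cur with
      | Some e =>
          let L' := insert L e in
          let N' := nub (map (canon L') N) in
          if (if existsb is_zero N' then true
              else refute n L' N' (simp (decide_by L' N') cur) rest)
          then refute n L (e :: N) (simp (decide_not e) cur) rest
          else false
      | None =>
          match rest with
          | [] => false
          | b :: rest' => refute n L N (simp (decide_by L N) b) rest'
          end
      end
  end.

Definition refutable (fuel vars : nat) (N : list form) (batches : list (list clause))
    : bool :=
  let L := repeat None vars in
  refute fuel L (map (canon L) N) [] (map (simp (decide_by L [])) batches).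



(** * Soundness of the refutation procedure *)

Lemma reduce_sound L env e :
  sat env L -> eq_mod1 (eval env (reduce L e)) (eval env e).
Proof.
  revert env e; induction L as [|o L IH]; intros env e; simpl.
  { intros _; apply eq_mod1_refl. }
  intros [Ho HL]. rewrite (eval_hd_tl env e). destruct o as [r|].
  - destruct (Z.eqb_spec (hd 0 e / hd 0 r)%Z 0) as [_|_].
    + rewrite eval_hd_tl; simpl.
      refine (eq_mod1_shift _ _ _ _ _ (IH (tl env) (tl e) HL)); lra.
    + rewrite eval_hd_tl; simpl.
      set (q := (hd 0 e / hd 0 r)%Z).
      apply (eq_mod1_scale (- q) _ _ (IZR (- q) * eval env r) 0) in Ho; [|lra].
      refine (eq_mod1_add _ _ _ _ _ _ _ (IH (tl env) (axpy (- q) (tl r) (tl e)) HL) Ho).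
      rewrite eval_axpy, (eval_hd_tl env r), minus_IZR, mult_IZR, opp_IZR; lra.
  - rewrite eval_hd_tl; simpl.
    refine (eq_mod1_shift _ _ _ _ _ (IH (tl env) (tl e) HL)); lra.
Qed.

Lemma euclid_sound n env e e' :
  eq_mod1 (eval env e) 0 -> eq_mod1 (eval env e') 0 ->
  eq_mod1 (eval env (fst (euclid n e e'))) 0 /\
  eq_mod1 (eval env (snd (euclid n e e'))) 0.
Proof.
  revert e e'; induction n as [|n IH]; intros e e' H H'; simpl; [easy|].
  destruct (Z.eqb _ _); [easy|]. apply IH; [easy|].
  rewrite eval_axpy. set (q := (- (hd 0 e / hd 0 e'))%Z).
  apply (eq_mod1_scale q _ _ (IZR q * eval env e') 0) in H'; [|lra].
  refine (eq_mod1_add _ _ _ _ _ _ _ H H'); lra.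
Qed.

Arguments euclid : simpl never.

Lemma positive_sound env e :
  eq_mod1 (eval env e) 0 -> eq_mod1 (eval env (positive e)) 0.
Proof.
  unfold positive; destruct (Z.ltb _ _); [|easy].
  rewrite eval_fopp; apply eq_mod1_opp; lra.
Qed.

Lemma tl_sound env e :
  hd 0%Z e = 0%Z -> eq_mod1 (eval env e) 0 -> eq_mod1 (eval (tl env) (tl e)) 0.
Proof. intros H; rewrite (eval_hd_tl env), H; apply eq_mod1_shift; lra. Qed.

(** Only integer combinations of valid congruences are formed, and these stay valid modulo 1. *)
Lemma insert_sound L env e :
  sat env L -> eq_mod1 (eval env e) 0 -> sat env (insert L e).
Proof.
  revert env e; induction L as [|o L IH]; intros env e; simpl; [easy|].
  intros [Ho HL] He. destruct (Z.eqb_spec (hd 0%Z e) 0) as [E|_].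
  { split; [easy|]. apply IH; [easy|]. now apply tl_sound. }
  destruct o as [r|]; simpl.
  - destruct (euclid_sound 100 env r e Ho He) as [H H'].
    destruct (euclid 100 r e) as [r' e']; simpl in *. split.
    + now apply positive_sound.
    + destruct (Z.eqb_spec (hd 0%Z e') 0); [|easy].
      apply IH; [easy|]. now apply tl_sound.
  - split; [now apply positive_sound|easy].
Qed.

Lemma holds_ext env e e' :
  eq_mod1 (eval env e) (eval env e') -> holds env e = holds env e'.
Proof.
  intros H; apply ceq_ext; split; intros H'.
  - refine (eq_mod1_trans _ _ _ _ H'); refine (eq_mod1_opp _ _ _ _ _ H); lra.
  - exact (eq_mod1_trans _ _ _ H H').
Qed.

Lemma canon_sound L env e : sat env L -> holds env (canon L e) = holds env e.
Proof.
  intros HL; unfold canon; destruct (lex_le _ _).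
  - rewrite (holds_ext env _ (fopp e)) by now apply reduce_sound.
    apply ceq_ext; rewrite eval_fopp; split; apply eq_mod1_opp; lra.
  - now apply holds_ext, reduce_sound.
Qed.

Lemma is_zero_sound env e : is_zero e = true -> holds env e = true.
Proof.
  intros H; apply ceqP.
  replace (eval env e) with 0; [apply eq_mod1_refl|].
  revert env H; induction e as [|[| |] e IH]; intros [|x env]; simpl; try easy.
  intros H; rewrite <- IH; [lra|easy].
Qed.

Lemma form_eqb_eq e e' : form_eqb e e' = true -> e = e'.
Proof.
  revert e'; induction e as [|a e IH]; intros [|b e']; simpl; try easy.
  destruct (Z.eqb_spec a b) as [->|]; [|easy].
  intros H; now rewrite (IH e').
Qed.

Definition all_fail (env : list R) (N : list form) : Prop :=
  Forall (fun e => holds env e = false) N.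

Lemma mem_sound env e N : all_fail env N -> mem e N = true -> holds env e = false.
Proof.
  induction 1 as [|e' N He HN IH]; simpl; [easy|].
  destruct (form_eqb e e') eqn:E; [|easy].
  now rewrite (form_eqb_eq _ _ E).
Qed.

Lemma nub_sound env N : all_fail env N -> all_fail env (nub N).
Proof.
  induction 1 as [|e N He HN IH]; simpl; [constructor|].
  destruct (mem _ _); [easy|]. now constructor.
Qed.

Lemma map_canon_sound env L N :
  sat env L -> all_fail env N -> all_fail env (map (canon L) N).
Proof.
  intros HL; induction 1; simpl; constructor; trivial.
  now rewrite canon_sound.
Qed.

Lemma no_zero env N : all_fail env N -> existsb is_zero N = false.
Proof.
  induction 1 as [|e N He HN IH]; simpl; [easy|].
  rewrite IH, orb_false_r. apply not_true_is_false; intros H.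
  rewrite (is_zero_sound env e H) in He; discriminate.
Qed.

Lemma parity_app env l l' : parity env (l ++ l') = xorb (parity env l) (parity env l').
Proof.
  induction l as [|e l IH]; simpl; [now destruct (parity env l')|].
  now rewrite IH, xorb_assoc.
Qed.

Lemma parity_toggle env e l : parity env (toggle e l) = xorb (holds env e) (parity env l).
Proof.
  induction l as [|e' l IH]; simpl; [easy|].
  destruct (form_eqb e e') eqn:E.
  - rewrite (form_eqb_eq _ _ E). now rewrite <- xorb_assoc, xorb_nilpotent, xorb_false_l.
  - simpl; rewrite IH. now destruct (holds env e), (holds env e'), (parity env l).
Qed.

Definition decides (env : list R) (decide : form -> status) : Prop :=
  forall e, match decide e with
            | Yes => holds env e = true
            | No => holds env e = false
            | Unknown e' => holds env e' = holds env e
            end.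

Lemma decide_by_sound env L N :
  sat env L -> all_fail env N -> decides env (decide_by L N).
Proof.
  intros HL HN e; unfold decide_by; rewrite <- (canon_sound L env e HL).
  destruct (is_zero _) eqn:Z; [now apply is_zero_sound|].
  destruct (mem _ _) eqn:M; [|easy]. now apply mem_sound with N.
Qed.

Lemma decide_not_sound env e : holds env e = false -> decides env (decide_not e).
Proof.
  intros H e'; unfold decide_not.
  destruct (form_eqb e e') eqn:E; [|easy]. now rewrite <- (form_eqb_eq _ _ E).
Qed.

Lemma simp_guards_sound env decide gs : decides env decide ->
  match simp_guards decide gs with
  | None => True
  | Some gs' => forallb (holds env) gs' = true -> forallb (holds env) gs = true
  end.
Proof.
  intros Hd; induction gs as [|g gs IH]; simpl; [easy|].
  specialize (Hd g); destruct (decide g) as [| |e]; simpl; trivial.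
  - now rewrite Hd.
  - destruct (simp_guards decide gs) as [gs'|]; simpl; trivial.
    rewrite Hd, !andb_true_iff; tauto.
Qed.

Lemma simp_atoms_sound env decide l : decides env decide ->
  parity env l = xorb (fst (simp_atoms decide l)) (parity env (snd (simp_atoms decide l))).
Proof.
  intros Hd; induction l as [|e l IH]; simpl; [easy|].
  rewrite IH; destruct (simp_atoms decide l) as [b r]; simpl.
  specialize (Hd e); destruct (decide e) as [| |e']; simpl.
  - rewrite Hd; now destruct b, (parity env r).
  - rewrite Hd; now destruct b, (parity env r).
  - rewrite parity_toggle, Hd; now destruct b, (parity env r), (holds env e).
Qed.

Lemma simp_sound env decide l : decides env decide ->
  Forall (clause_ok env) l -> Forall (clause_ok env) (simp decide l).
Proof.
  intros Hd H; apply Forall_flat_map; revert H; apply Forall_impl.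
  intros c Hc; unfold simp_clause.
  pose proof (simp_guards_sound env decide (guards c) Hd) as Hg.
  pose proof (simp_atoms_sound env decide (atoms c) Hd) as Ha.
  destruct (simp_guards decide (guards c)) as [gs|]; [|constructor].
  destruct (simp_atoms decide (atoms c)) as [b r]; simpl in Ha.
  assert (Forall (clause_ok env) [Clause gs (xorb (target c) b) r]).
  { constructor; [|constructor]. intros G; simpl in *. specialize (Hc (Hg G)).
    rewrite <- Hc, Ha. now destruct b, (parity env r). }
  destruct (xorb (target c) b), r; trivial; constructor.
Qed.

Lemma not_violated env l : Forall (clause_ok env) l -> existsb violated l = false.
Proof.
  induction 1 as [|c l Hc Hl IH]; simpl; [easy|].
  rewrite IH, orb_false_r.
  destruct c as [[|g gs] [|] [|a r]]; trivial. discriminate (Hc eq_refl).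
Qed.

(** At each case analysis, [env] satisfies the assumptions of one of the two branches, and by
    induction that branch is not refuted. *)
Lemma refute_sound env fuel L N cur rest :
  sat env L -> all_fail env N -> Forall (clause_ok env) cur ->
  Forall (Forall (clause_ok env)) rest ->
  refute fuel L N cur rest = false.
Proof.
  revert L N cur rest; induction fuel as [|n IH]; intros L N cur rest HL HN Hc Hr;
    simpl; [easy|].
  rewrite (not_violated env) by easy.
  destruct (pick None cur) as [e|].
  - destruct (holds env e) eqn:E.
    + assert (HL' : sat env (insert L e)) by (apply insert_sound; [|apply ceqP]; easy).
      assert (HN' : all_fail env (nub (map (canon (insert L e)) N)))
        by (apply nub_sound, map_canon_sound; easy).
      rewrite (no_zero env), IH; trivial.
      now apply simp_sound; [apply decide_by_sound|].
    + match goal with |- (if ?b then _ else _) = false => destruct b end; [|easy].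
      apply IH; trivial; [now constructor|].
      now apply simp_sound; [apply decide_not_sound|].
  - destruct Hr as [|b rest Hb Hr]; [easy|].
    apply IH; trivial. now apply simp_sound; [apply decide_by_sound|].
Qed.

Lemma refutable_sound env fuel vars N batches :
  refutable fuel vars N batches = true -> all_fail env N ->
  Forall (Forall (clause_ok env)) batches -> False.
Proof.
  intros H HN Hb.
  assert (HL : forall k e, sat e (repeat None k)) by (induction k; simpl; auto).
  unfold refutable in H; rewrite (refute_sound env) in H; [discriminate| | | |]; auto.
  - now apply map_canon_sound.
  - apply Forall_map; revert Hb; apply Forall_impl; intros b Hb.
    apply simp_sound; trivial. apply decide_by_sound; [easy|constructor].
Qed.


(** * Recolourings and their reflections *)

(* Repeated indices in [v] cancel, and an index out of range designates the point 0. *)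
Definition flips (w : list R) (v : list nat) (x : R) : bool :=
  fold_right (fun j => xorb (ceq x (nth j w 0))) false v.

Definition recolor (f : R -> bool) (w : list R) (v : list nat) (x : R) : bool :=
  xorb (f x) (flips w v x).

Definition reflective (f : R -> bool) (b : R) : Prop := forall x, f (b - x) = f x.

Lemma flips_app w u v x : flips w (u ++ v) x = xorb (flips w u x) (flips w v x).
Proof.
  induction u as [|i u IH]; simpl; [now destruct (flips w v x)|].
  now rewrite IH, xorb_assoc.
Qed.

Lemma recolor_app f w u v x : recolor f w (v ++ u) x = recolor (recolor f w u) w v x.
Proof.
  unfold recolor; rewrite flips_app.
  now destruct (f x), (flips w u x), (flips w v x).
Qed.

Lemma recolor_cons f w i v x :
  recolor f w (i :: v) x = xorb (recolor f w v x) (ceq x (nth i w 0)).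
Proof.
  unfold recolor; simpl.
  now destruct (f x), (flips w v x), (ceq x (nth i w 0)).
Qed.

Lemma recolor_periodic f w v : periodic f -> periodic (recolor f w v).
Proof.
  intros Hf x; unfold recolor; rewrite Hf; f_equal.
  induction v as [|j v IH]; simpl; [easy|]. rewrite IH; f_equal.
  apply ceq_ext; split; intros [k H].
  - exists (k - 1)%Z; rewrite minus_IZR; lra.
  - exists (k + 1)%Z; rewrite plus_IZR; lra.
Qed.

(* [(v, e)] stands for the reflection [x |-> eval env e - x], which is to preserve
   the recolouring at [v]. *)
Definition gen : Type := list nat * form.

Definition gen_ok (f : R -> bool) (env : list R) (g : gen) : Prop :=
  reflective (recolor f env (fst g)) (eval env (snd g)).

Definition label (v : list nat) (p : form) : list form :=
  map (fun j => fsub p (fvar j)) v.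

Lemma parity_label env v p : parity env (label v p) = flips env v (eval env p).
Proof.
  induction v as [|j v IH]; simpl; [easy|].
  now rewrite IH, holds_fsub, eval_fvar.
Qed.

Fixpoint walk (p : form) (word : list gen) : form * list form :=
  match word with
  | [] => (p, [])
  | (v, e) :: word' =>
      let q := fsub e p in
      let (r, l) := walk q word' in
      (r, label v p ++ label v q ++ l)
  end.

Definition word_clause (word : list gen) (i : nat) : clause :=
  let p := fvar i in
  let (q, l) := walk p word in
  Clause [fsub q p] false l.

(** A walk that meets the triple can be started there, so three starting points suffice once the
    cyclic shifts of a word are included. *)
Definition word_clauses (words : list (list gen)) : list clause :=
  flat_map (fun w => map (word_clause w) [0; 1; 2]%nat) words.

(** A step preserves the recolouring at [v], so the colour under [f] changes according to the flips
    at both ends of the step. *)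
Lemma walk_sound f env word p : Forall (gen_ok f env) word ->
  f (eval env (fst (walk p word))) =
  xorb (f (eval env p)) (parity env (snd (walk p word))).
Proof.
  revert p; induction word as [|[v e] word IH]; intros p H; simpl.
  { now destruct (f (eval env p)). }
  inversion_clear H as [|? ? Hg Hw]. specialize (IH (fsub e p) Hw).
  destruct (walk (fsub e p) word) as [r l]; simpl in *.
  rewrite IH, !parity_app, !parity_label, eval_fsub.
  specialize (Hg (eval env p)); unfold recolor in Hg; simpl in Hg.
  destruct (f (eval env e - eval env p)), (f (eval env p)),
    (flips env v (eval env e - eval env p)), (flips env v (eval env p)),
    (parity env l); easy.
Qed.

(* Around a closed walk the colour changes an even number of times. *)
Lemma word_clauses_ok f env words : periodic f ->
  Forall (Forall (gen_ok f env)) words -> Forall (clause_ok env) (word_clauses words).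
Proof.
  intros Hf H; apply Forall_flat_map; revert H; apply Forall_impl; intros word Hw.
  apply Forall_map, Forall_forall; intros i _. unfold word_clause.
  pose proof (walk_sound f env word (fvar i) Hw) as E.
  destruct (walk (fvar i) word) as [q l]; unfold clause_ok; simpl in *.
  rewrite andb_true_r, holds_fsub, ceqP; intros G.
  rewrite (periodic_eq_mod1 f _ _ Hf G) in E.
  now destruct (f (eval env (fvar i))), (parity env l).
Qed.

(* A product of three reflections is a reflection, so the hexagons close up. *)
Definition triple_words (a b c : gen) : list (list gen) :=
  [[c; b; a; c; b; a]; [b; a; c; b; a; c]; [a; c; b; a; c; b]].

(** Four reflections compose to a translation; the guard of the clause tests whether it is
    trivial. *)
Definition quad_words (a b c d : gen) : list (list gen) :=
  [[a; b; c; d]; [b; c; d; a]; [c; d; a; b]; [d; a; b; c]].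

Fixpoint pairs {A : Type} (l : list A) : list (A * A) :=
  match l with
  | [] => []
  | a :: l' => map (pair a) l' ++ pairs l'
  end.

Definition common_words (prev : list gen) (g : gen) : list (list gen) :=
  map (fun a => [a; g]) prev ++
  flat_map (fun ab => triple_words (fst ab) (snd ab) g) (pairs prev).

(** Generators enter one at a time, each with the walks linking it to earlier ones, so that small
    subsystems are tried first. *)
Fixpoint batches (extra : list gen -> gen -> list clause) (prev gs : list gen)
    : list (list clause) :=
  match gs with
  | [] => []
  | g :: gs' =>
      (word_clauses (common_words prev g) ++ extra prev g)
      :: batches extra (prev ++ [g]) gs'
  end.

Lemma in_pairs {A : Type} (l : list A) a b : In (a, b) (pairs l) -> In a l /\ In b l.
Proof.
  induction l as [|c l IH]; simpl; [easy|].
  rewrite in_app_iff, in_map_iff; intros [[d [E H]]|H].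
  - inversion E; subst; auto.
  - destruct (IH H); auto.
Qed.

Lemma batches_ok f env (Q : gen -> Prop) extra prev gs : periodic f ->
  (forall g, Q g -> gen_ok f env g) ->
  (forall prev' g, Forall Q prev' -> Q g -> Forall (clause_ok env) (extra prev' g)) ->
  Forall Q prev -> Forall Q gs ->
  Forall (Forall (clause_ok env)) (batches extra prev gs).
Proof.
  intros Hf HQ He Hp Hg; revert prev Hp; induction Hg as [|g gs Hg Hgs IH];
    intros prev Hp; simpl; constructor.
  - apply Forall_app; split; [|now apply He].
    apply word_clauses_ok with f; trivial.
    rewrite Forall_forall in Hp. apply Forall_app; split.
    + apply Forall_map, Forall_forall; intros a Ha. repeat constructor; auto.
    + apply Forall_flat_map, Forall_forall; intros [a b] H; simpl.
      apply in_pairs in H as [Ha%Hp Hb%Hp]. repeat constructor; auto.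
  - apply IH, Forall_app; split; trivial. now constructor.
Qed.

(** Lists add as symmetric differences; an empty result certifies that all flips cancel. *)
Fixpoint cancel (v : list nat) : list nat :=
  let toggle i := fix t l := match l with
    | [] => [i]
    | j :: l' => if Nat.eqb i j then l' else j :: t l' end in
  match v with
  | [] => []
  | i :: v' => toggle i (cancel v')
  end.

Lemma flips_cancel w v x : flips w (cancel v) x = flips w v x.
Proof.
  induction v as [|i v IH]; simpl; [easy|].
  rewrite <- IH; generalize (cancel v) as l; clear; induction l as [|j l IH]; simpl; [easy|].
  destruct (Nat.eqb_spec i j) as [->|].
  - now destruct (ceq x (nth j w 0)), (flips w l x).
  - simpl; rewrite IH.
    now destruct (ceq x (nth i w 0)), (ceq x (nth j w 0)), (flips w l x).
Qed.

(* If the reflection of [a] exchanges the points [i] and [j], it also preserves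
   the recolouring [b] that differs from [a] in these points. *)
Definition unique_clauses (a b : gen) : list clause :=
  flat_map (fun ij : nat * nat =>
    let (i, j) := ij in
    match cancel ((if Nat.eqb i j then [i] else [i; j]) ++ fst a ++ fst b) with
    | [] => [Clause [fsub (snd a) (fadd (fvar i) (fvar j))] true [fsub (snd a) (snd b)]]
    | _ => []
    end) [(0, 0); (1, 1); (2, 2); (0, 1); (0, 2); (1, 2)]%nat.

Lemma unique_clauses_ok f env a b :
  (forall c c', reflective (recolor f env (fst b)) c ->
     reflective (recolor f env (fst b)) c' -> eq_mod1 c c') ->
  gen_ok f env a -> gen_ok f env b -> Forall (clause_ok env) (unique_clauses a b).
Proof.
  intros U Ha Hb; apply Forall_flat_map, Forall_forall; intros [i j] _.
  set (d := if Nat.eqb i j then [i] else [i; j]).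
  destruct (cancel (d ++ fst a ++ fst b)) eqn:E; constructor; [|constructor].
  unfold clause_ok; simpl.
  rewrite andb_true_r, xorb_false_r, !holds_fsub, !ceqP, eval_fadd, !eval_fvar.
  intros G; apply U; trivial.
  (* The reflection of [a] exchanges the points [i] and [j], or fixes the point if [i = j]. *)
  assert (D : forall x, flips env d (eval env (snd a) - x) = flips env d x).
  { intros x.
    assert (S : forall k l, eq_mod1 (eval env (snd a)) (nth k env 0 + nth l env 0) ->
              ceq (eval env (snd a) - x) (nth k env 0) = ceq x (nth l env 0)).
    { clear; intros k l G; apply ceq_ext; split; intros H.
      - apply (eq_mod1_opp _ _ 0 (eval env (snd a) - x - nth k env 0)) in H; [|lra].
        refine (eq_mod1_add _ _ _ _ _ _ _ G H); lra.
      - apply (eq_mod1_opp _ _ (nth l env 0) x) in H; [|lra].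
        refine (eq_mod1_add _ _ _ _ _ _ _ G H); lra. }
    unfold d; destruct (Nat.eqb_spec i j) as [->|_]; simpl.
    - now rewrite (S j j).
    - rewrite (S i j), (S j i) by (trivial; now rewrite Rplus_comm).
      now destruct (ceq x (nth i env 0)), (ceq x (nth j env 0)). }
  (* The empty [cancel] makes [fst b] the symmetric difference of [d] and [fst a]. *)
  assert (V : forall x, flips env (fst b) x = xorb (flips env d x) (flips env (fst a) x)).
  { intros x; pose proof (flips_cancel env (d ++ fst a ++ fst b) x) as F.
    rewrite E, !flips_app in F; simpl in F.
    now destruct (flips env d x), (flips env (fst a) x), (flips env (fst b) x). }
  intros x; specialize (Ha x); unfold recolor in *; rewrite !V, D.
  destruct (flips env d x), (f (eval env (snd a) - x)), (f x),
    (flips env (fst a) (eval env (snd a) - x)), (flips env (fst a) x); easy.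
Qed.

(** * Scalene triples *)

Definition double (i : nat) : form := fadd (fvar i) (fvar i).

Definition scalene_forms : list form :=
  let s i j k := fsub (double i) (fadd (fvar j) (fvar k)) in
  [s 0 1 2; s 1 0 2; s 2 0 1;
   fsub (fvar 0) (fvar 1); fsub (fvar 0) (fvar 2); fsub (fvar 1) (fvar 2)]%nat.

(** Integer linear algebra holds in every abelian group. This clause supplies a fact about the
    circle, its having only one element of order two. *)
Definition half_turn_clause : clause :=
  Clause [fsub (double 0) (double 1); fsub (double 0) (double 2)] true [].

Definition axes : list gen := map (fun i => ([], double i)) [0; 1; 2]%nat.

(** A colouring symmetric about each point of the triple stays symmetric about a point when that
    point alone is recoloured, so only larger subsets are informative. *)
Definition large_subsets : list (list nat) :=
  [[0; 1; 2]; [0; 1]; [0; 2]; [1; 2]]%nat.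

(** These walks go back and forth across one axis, and force [v] to be invariant under reflection
    about each point of the triple. Scalenity would then give all three points the same double. *)
Definition axis_batches (v : list nat) : list (list clause) :=
  [[half_turn_clause];
   word_clauses (map (fun i => [([], double i); (v, double i)]) [0; 1; 2]%nat)].

(** The additional walks close up when [g] and an earlier reflection differ by the translation
    composed of two axes. *)
Definition rotation_batches : list (list clause) :=
  [half_turn_clause] ::
  batches (fun prev g => word_clauses
      (flat_map (fun rs => flat_map (quad_words g (fst rs) (snd rs)) prev)
         (list_prod axes axes)))
    axes (combine large_subsets (map fvar (seq 3 4))).

Definition all_subsets : list (list nat) :=
  [[]; [0]; [1]; [0; 1]; [2]; [0; 2]; [1; 2]; [0; 1; 2]]%nat.

Definition reflection_batches : list (list clause) :=
  [half_turn_clause] ::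
  batches (fun prev g => flat_map (fun a => unique_clauses a g ++ unique_clauses g a) prev)
    [] (combine all_subsets (map fvar (seq 3 8))).

Lemma axis_refuted :
  forallb (fun v => refutable 1000 3 scalene_forms (axis_batches v)) large_subsets = true.
Proof. vm_compute; reflexivity. Qed.

(** Seven variables: the triple and one reflection for each large subset. *)
Lemma rotation_refuted : refutable 1000 7 scalene_forms rotation_batches = true.
Proof. vm_cast_no_check (eq_refl true). Qed.

(** Eleven variables: the triple and one reflection for each of the eight recolourings. *)
Lemma reflection_refuted : refutable 1000 11 scalene_forms reflection_batches = true.
Proof. vm_cast_no_check (eq_refl true). Qed.

(** * Distinguishing recolourings of a scalene triple *)

Definition scalene (w0 w1 w2 : R) : Prop :=
  ~ eq_mod1 (w0 + w0) (w1 + w2) /\ ~ eq_mod1 (w1 + w1) (w0 + w2) /\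
  ~ eq_mod1 (w2 + w2) (w0 + w1) /\
  ~ eq_mod1 w0 w1 /\ ~ eq_mod1 w0 w2 /\ ~ eq_mod1 w1 w2.

Lemma scalene_forms_fail w0 w1 w2 bs :
  scalene w0 w1 w2 -> all_fail (w0 :: w1 :: w2 :: bs) scalene_forms.
Proof.
  intros (A & B & C & D & E & F).
  repeat constructor; unfold double;
    rewrite holds_fsub, ?eval_fadd, !eval_fvar; now apply ceq_false.
Qed.

(* Two distinct points with the same double are antipodal. *)
Lemma half_turn_clause_ok w0 w1 w2 bs :
  scalene w0 w1 w2 -> clause_ok (w0 :: w1 :: w2 :: bs) half_turn_clause.
Proof.
  intros (_ & _ & _ & N1 & N2 & N3).
  unfold clause_ok, half_turn_clause, double; cbn [guards target atoms forallb parity fold_right].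
  rewrite andb_true_r, !holds_fsub, !eval_fadd, !eval_fvar, andb_true_iff, !ceqP; simpl.
  intros [[k Hk] [l Hl]]; exfalso.
  destruct (Z.Even_or_Odd k) as [[m ->]|[m ->]].
  { apply N1; exists m. rewrite mult_IZR in Hk; lra. }
  destruct (Z.Even_or_Odd l) as [[n ->]|[n ->]].
  { apply N2; exists n. rewrite mult_IZR in Hl; lra. }
  apply N3; exists (n - m)%Z.
  rewrite minus_IZR. rewrite plus_IZR, mult_IZR in Hk, Hl. lra.
Qed.

(* A colouring with a translation symmetry that acquires another symmetry by
   recolouring the single point [w] is symmetric about [w]. *)
Lemma translation_axis f t w g : periodic f ->
  ~ eq_mod1 t 0 -> (forall x, f (x + t) = f x) ->
  ~ is_id g -> (forall x, xorb (f (act g x)) (ceq (act g x) w) = xorb (f x) (ceq x w)) ->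
  reflective f (w + w).
Proof.
  intros Hf Ht Sf Hg Sg.
  assert (Ew : ceq w w = true) by apply ceqP, eq_mod1_refl.
  assert (Et : ceq (w + t) w = false).
  { apply ceq_false; intros H; apply Ht; revert H; apply eq_mod1_shift; lra. }
  destruct g as [q|a]; simpl in Sg.
  - exfalso.
    assert (Eq : ceq (w + q) w = false).
    { apply ceq_false; intros H; apply Hg; intros x; simpl; revert H.
      apply eq_mod1_shift; lra. }
    (* [f] agrees at [w] and [w + t], and also at their images, but only [w] is recoloured. *)
    pose proof (Sg w) as S1; pose proof (Sg (w + t)) as S2.
    replace (w + t + q) with (w + q + t) in S2 by lra.
    rewrite !Sf, Et in S2. rewrite Ew, Eq in S1.
    destruct (ceq (w + q + t) w) eqn:E.
    + apply ceqP in E.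
      assert (f (w + q) = f w).
      { rewrite <- (Sf (w + q)); now apply periodic_eq_mod1. }
      rewrite H in S1; destruct (f w); discriminate.
    + destruct (f (w + q)), (f w); discriminate.
  - set (b := 2 * a) in *.
    destruct (classic (eq_mod1 b (w + w))) as [E|E].
    + intros x.
      rewrite (periodic_eq_mod1 f (w + w - x) (- x + b) Hf)
        by (revert E; apply eq_mod1_opp; lra).
      specialize (Sg x).
      replace (ceq (- x + b) w) with (ceq x w) in Sg.
      { now destruct (f (- x + b)), (f x), (ceq x w). }
      apply ceq_ext; split; intros H.
      * apply (eq_mod1_opp _ _ w x) in H; [|lra].
        refine (eq_mod1_add _ _ _ _ _ _ _ E H); lra.
      * apply (eq_mod1_opp _ _ w (- x + b)) in H; [|lra].
        refine (eq_mod1_add _ _ _ _ _ _ _ E H); lra.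
    + exfalso.
      assert (Eb : ceq (- w + b) w = false).
      { apply ceq_false; intros H; apply E; revert H; apply eq_mod1_shift; lra. }
      (* The same comparison of [w] with [w + t], now for a reflection that moves [w]. *)
      pose proof (Sg w) as S1; pose proof (Sg (w + t)) as S2.
      rewrite Ew, Eb in S1.
      replace (f (- (w + t) + b)) with (f (- w + b)) in S2
        by (rewrite <- (Sf (- (w + t) + b)); f_equal; lra).
      rewrite Sf, Et in S2.
      destruct (ceq (- (w + t) + b) w) eqn:F.
      * apply ceqP in F.
        assert (H : f (- w + b) = f w).
        { rewrite <- (Sf w). apply periodic_eq_mod1; trivial.
          revert F; apply eq_mod1_shift; lra. }
        rewrite H in S1; destruct (f w); discriminate.
      * destruct (f (- w + b)), (f w); discriminate.
Qed.

Lemma not_distinguishing c : periodic c -> ~ distinguishing c ->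
  exists g, ~ is_id g /\ forall x, c (act g x) = c x.
Proof.
  intros Hc Hd; apply NNPP; intros N; apply Hd; split; trivial; intros g Hg.
  apply NNPP; intros Hi; apply N; now exists g.
Qed.

Lemma gen_ok_var f env v k :
  reflective (recolor f env v) (nth k env 0) -> gen_ok f env (v, fvar k).
Proof. unfold gen_ok; simpl; now rewrite eval_fvar. Qed.

Lemma gen_ok_axis f env v i :
  reflective (recolor f env v) (nth i env 0 + nth i env 0) -> gen_ok f env (v, double i).
Proof. unfold gen_ok, double; simpl; now rewrite eval_fadd, eval_fvar. Qed.

Definition bounded (v : list nat) : Prop := Forall (fun j => (j < 3)%nat) v.

Lemma reflective_ext f f' b : (forall x, f x = f' x) -> reflective f b -> reflective f' b.
Proof. intros E H x; rewrite <- !E; apply H. Qed.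

(** Repeated indices are allowed, so the property passes to a recoloured base by appending lists. *)
Definition recolorings_symmetric (f : R -> bool) (w : list R) : Prop :=
  forall v, bounded v ->
  exists g, ~ is_id g /\ forall x, recolor f w v (act g x) = recolor f w v x.

Lemma rotation_axes f w u t i : periodic f -> recolorings_symmetric f w ->
  bounded u -> (i < 3)%nat -> ~ eq_mod1 t 0 ->
  (forall x, recolor f w u (x + t) = recolor f w u x) ->
  reflective (recolor f w u) (nth i w 0 + nth i w 0).
Proof.
  intros Hf Hsym Hu Hi Ht Hs.
  destruct (Hsym (i :: u)) as (g & Hg & S); [now constructor|].
  apply translation_axis with t g; trivial; [now apply recolor_periodic|].
  intros x; rewrite <- !recolor_cons; apply S.
Qed.

(** With the colouring at [u] as base, all three points give axes of symmetry, and every recolouring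
    at a large subset has a reflection. The computation refutes this. *)
Lemma no_rotation w0 w1 w2 f u t : scalene w0 w1 w2 -> periodic f ->
  recolorings_symmetric f [w0; w1; w2] -> bounded u ->
  (forall x, recolor f [w0; w1; w2] u (x + t) = recolor f [w0; w1; w2] u x) ->
  eq_mod1 t 0.
Proof.
  intros Hw Hf Hsym Hu Hs; apply NNPP; intros Ht.
  set (w := [w0; w1; w2]) in *.
  set (f' := recolor f w u) in *.
  assert (Hf' : periodic f') by now apply recolor_periodic.
  assert (Ax : forall i, (i < 3)%nat -> reflective f' (nth i w 0 + nth i w 0))
    by (intros i Hi; now apply rotation_axes with t).
  assert (Ax0 : forall i, (i < 3)%nat ->
            reflective (recolor f' w []) (nth i w 0 + nth i w 0)).
  { intros i Hi; apply reflective_ext with f'; [|now apply Ax].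
    intros x; unfold recolor; simpl; now rewrite xorb_false_r. }
  assert (B : forall v, In v large_subsets -> exists b, reflective (recolor f' w v) b).
  { intros v Hv.
    assert (Bv : bounded (v ++ u)).
    { apply Forall_app; split; trivial.
      simpl in Hv; decompose [or] Hv; subst; try easy; repeat constructor; lia. }
    destruct (Hsym (v ++ u) Bv) as ([q|a] & Hg & S); simpl in S.
    (* A translation here would make the recolouring at [v] symmetric about all three points, as
       [f'] already is. *)
    - exfalso.
      assert (Hq : ~ eq_mod1 q 0).
      { intros H; apply Hg; intros x; simpl; revert H; apply eq_mod1_shift; lra. }
      assert (Axv : forall i, (i < 3)%nat ->
                reflective (recolor f' w v) (nth i w 0 + nth i w 0)).
      { intros i Hi; apply reflective_ext with (recolor f w (v ++ u)).
        - intros x; apply recolor_app.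
        - now apply rotation_axes with q. }
      pose proof axis_refuted as Hr; rewrite forallb_forall in Hr.
      refine (refutable_sound w _ _ _ _ (Hr v Hv) (scalene_forms_fail _ _ _ [] Hw) _).
      constructor; [constructor; [now apply half_turn_clause_ok|constructor]|].
      constructor; [|constructor].
      apply word_clauses_ok with f'; trivial.
      apply Forall_map, Forall_forall; intros i Hi.
      assert (i < 3)%nat by (simpl in Hi; lia).
      constructor; [|constructor; [|constructor]]; now apply gen_ok_axis; auto.
    - exists (2 * a); intros x; unfold f'; rewrite <- !recolor_app, <- (S x).
      f_equal; lra. }
  destruct (B [0; 1; 2]%nat) as [b1 H1]; [simpl; tauto|].
  destruct (B [0; 1]%nat) as [b2 H2]; [simpl; tauto|].
  destruct (B [0; 2]%nat) as [b3 H3]; [simpl; tauto|].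
  destruct (B [1; 2]%nat) as [b4 H4]; [simpl; tauto|].
  set (env := [w0; w1; w2; b1; b2; b3; b4]).
  assert (Hax : Forall (gen_ok f' env) axes).
  { repeat constructor; apply gen_ok_axis;
      [apply (Ax0 0%nat)|apply (Ax0 1%nat)|apply (Ax0 2%nat)]; lia. }
  refine (refutable_sound env _ _ _ _ rotation_refuted (scalene_forms_fail _ _ _ _ Hw) _).
  constructor; [constructor; [now apply half_turn_clause_ok|constructor]|].
  apply batches_ok with f' (gen_ok f' env); trivial.
  - intros prev g Hp Hg. apply word_clauses_ok with f'; trivial.
    rewrite Forall_forall in Hax, Hp.
    apply Forall_flat_map, Forall_forall; intros [r s] Hrs.
    apply in_prod_iff in Hrs as [Hr%Hax Hs'%Hax].
    apply Forall_flat_map, Forall_forall; intros d Hd%Hp.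
    repeat constructor; trivial.
  (* [env] extends [w], so both give the same recolouring at these explicit lists by computation. *)
  - repeat constructor; apply gen_ok_var; assumption.
Qed.

Lemma not_all_symmetric w0 w1 w2 f : scalene w0 w1 w2 -> periodic f ->
  ~ recolorings_symmetric f [w0; w1; w2].
Proof.
  intros Hw Hf Hsym. set (w := [w0; w1; w2]) in *.
  assert (NR : forall v t, bounded v ->
            (forall x, recolor f w v (x + t) = recolor f w v x) -> eq_mod1 t 0)
    by (intros v t; now apply no_rotation).
  assert (B : forall v, bounded v -> exists b, reflective (recolor f w v) b).
  { intros v Hv. destruct (Hsym v Hv) as ([q|a] & Hg & S); simpl in S.
    - exfalso; apply Hg; intros x; simpl.
      refine (eq_mod1_shift _ _ _ _ _ (NR v q Hv S)); lra.
    - exists (2 * a); intros x; rewrite <- (S x); f_equal; lra. }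
  assert (U : forall v, bounded v -> forall c c',
            reflective (recolor f w v) c -> reflective (recolor f w v) c' -> eq_mod1 c c').
  { intros v Hv c c' Hc Hc'.
    refine (eq_mod1_shift _ _ _ _ _ (NR v (c - c') Hv _)); [lra|].
    intros x; rewrite <- (Hc' x), <- (Hc (c' - x)); f_equal; lra. }
  assert (Hb : Forall bounded all_subsets) by (repeat constructor; lia).
  rewrite Forall_forall in Hb.
  destruct (B []) as [b0 H0]; [apply Hb; simpl; tauto|].
  destruct (B [0]%nat) as [b1 H1]; [apply Hb; simpl; tauto|].
  destruct (B [1]%nat) as [b2 H2]; [apply Hb; simpl; tauto|].
  destruct (B [0; 1]%nat) as [b3 H3]; [apply Hb; simpl; tauto|].
  destruct (B [2]%nat) as [b4 H4]; [apply Hb; simpl; tauto|].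
  destruct (B [0; 2]%nat) as [b5 H5]; [apply Hb; simpl; tauto|].
  destruct (B [1; 2]%nat) as [b6 H6]; [apply Hb; simpl; tauto|].
  destruct (B [0; 1; 2]%nat) as [b7 H7]; [apply Hb; simpl; tauto|].
  set (env := [w0; w1; w2; b0; b1; b2; b3; b4; b5; b6; b7]).
  refine (refutable_sound env _ _ _ _ reflection_refuted (scalene_forms_fail _ _ _ _ Hw) _).
  constructor; [constructor; [now apply half_turn_clause_ok|constructor]|].
  apply batches_ok with f (fun g => gen_ok f env g /\
    forall c c', reflective (recolor f env (fst g)) c ->
      reflective (recolor f env (fst g)) c' -> eq_mod1 c c'); trivial.
  - now intros g [].
  - intros prev g Hp [Hg Ug]. rewrite Forall_forall in Hp.
    apply Forall_flat_map, Forall_forall; intros a [Ha Ua]%Hp.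
    apply Forall_app; split; now apply unique_clauses_ok with f.
  - repeat constructor; try (apply gen_ok_var; assumption);
      simpl fst; match goal with |- forall c c', reflective (recolor f env ?v) c -> _ =>
        exact (U v (Hb v ltac:(simpl; tauto))) end.
Qed.

Lemma scalene_distinguishing w0 w1 w2 f : scalene w0 w1 w2 -> periodic f ->
  exists v, bounded v /\ distinguishing (recolor f [w0; w1; w2] v).
Proof.
  intros Hw Hf; apply NNPP; intros N.
  apply (not_all_symmetric w0 w1 w2 f Hw Hf); intros v Hv.
  apply not_distinguishing; [now apply recolor_periodic|].
  intros D; apply N; now exists v.
Qed.

(** Recolouring within the triple leaves the precolouring intact outside [W]. *)
Lemma P_of_scalene (W : R -> Prop) w0 w1 w2 : scalene w0 w1 w2 ->
  (forall x, eq_mod1 x w0 \/ eq_mod1 x w1 \/ eq_mod1 x w2 -> W x) -> P W.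
Proof.
  intros Hw HW p Hp.
  destruct (scalene_distinguishing w0 w1 w2 p Hw Hp) as (v & Hv & D).
  exists (recolor p [w0; w1; w2] v); split; trivial; intros x Hx.
  unfold recolor; replace (flips [w0; w1; w2] v x) with false;
    [now rewrite xorb_false_r|].
  clear D; induction Hv as [|j v Hj Hv IH]; simpl; [easy|].
  rewrite <- IH, ceq_false; [easy|].
  intros H; apply Hx, HW. destruct j as [|[|[|j]]]; simpl in H; [tauto..|lia].
Qed.

(** * Four points *)

Definition isosceles_clause (i j k : nat) : clause :=
  let s i j k := fsub (double i) (fadd (fvar j) (fvar k)) in
  Clause [] true [s i j k; s j i k; s k i j].

Definition multiple (m : Z) (i j : nat) : form := map (Z.mul m) (fsub (fvar i) (fvar j)).

(** Excludes the square: four distinct points whose differences are multiples of a quarter. *)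
Definition square_clause : clause :=
  Clause [multiple 4 1 0; multiple 4 2 0; multiple 4 3 0] true [].

(** Excludes quadruples on a regular pentagon, and coinciding points as well. *)
Definition no_fifths : list form :=
  map (fun ij => multiple 5 (fst ij) (snd ij)) (pairs [0; 1; 2; 3]%nat).

Definition isosceles_clauses : list clause :=
  [isosceles_clause 0 1 2; isosceles_clause 0 1 3;
   isosceles_clause 0 2 3; isosceles_clause 1 2 3; square_clause].

(** The classification of four points with only isosceles triples, the square and the pentagon being
    excluded. *)
Lemma isosceles_refuted : refutable 1000 4 no_fifths [isosceles_clauses] = true.
Proof. vm_compute; reflexivity. Qed.

Lemma holds_multiple env m i j :
  holds env (multiple m i j) = ceq (IZR m * (nth i env 0 - nth j env 0)) 0.
Proof. unfold holds, multiple; now rewrite eval_scale, eval_fsub, !eval_fvar. Qed.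

(* Any two of the three equations imply the third, so an isosceles triple
   satisfies an odd number of them. *)
Lemma isosceles_clause_ok env i j k :
  let a := nth i env 0 in let b := nth j env 0 in let c := nth k env 0 in
  ~ eq_mod1 a b -> ~ eq_mod1 a c -> ~ eq_mod1 b c -> ~ scalene a b c ->
  clause_ok env (isosceles_clause i j k).
Proof.
  intros a b c Nab Nac Nbc Hs _; unfold isosceles_clause, double; simpl.
  rewrite !holds_fsub, !eval_fadd, !eval_fvar; fold a b c.
  assert (E : forall x y z, eq_mod1 (x + x) (y + z) -> eq_mod1 (y + y) (x + z) ->
            eq_mod1 (z + z) (x + y)).
  { intros x y z [k1 H1] [k2 H2]; exists (- k1 - k2)%Z.
    rewrite minus_IZR, opp_IZR; lra. }
  pose proof (fun x y => iff_reflect _ _ (iff_sym (ceqP x y))) as ceqR.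
  destruct (ceqR (a + a) (b + c)) as [A|A], (ceqR (b + b) (a + c)) as [B|B],
    (ceqR (c + c) (a + b)) as [C|C]; trivial; exfalso.
  - apply C; now apply E.
  - apply B, (E a c b); trivial. now rewrite (Rplus_comm c b).
  - apply A, (E b c a); [now rewrite (Rplus_comm c a)|now rewrite (Rplus_comm b a)].
  - apply Hs; repeat split; trivial.
Qed.

(** A difference annihilated by 5 is a multiple of one fifth. Remainder 0 contradicts distinctness,
    and any other remainder is an [i] for [hT]. *)
Lemma fifths (w0 w1 w2 w3 x y : R)
  (hT : forall i : nat, (1 <= i <= 4)%nat ->
        forall x y, fourset w0 w1 w2 w3 x -> fourset w0 w1 w2 w3 y ->
        ~ eq_mod1 (x + INR i / 5)%R y) :
  fourset w0 w1 w2 w3 x -> fourset w0 w1 w2 w3 y -> ~ eq_mod1 x y ->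
  ~ eq_mod1 (5 * (x - y)) 0.
Proof.
  intros Hx Hy N [k Hk].
  pose proof (Z.div_mod k 5 ltac:(lia)) as D.
  pose proof (Z.mod_pos_bound k 5 ltac:(lia)) as B.
  set (r := Z.to_nat (k mod 5)).
  assert (Er : INR r = IZR (k mod 5))
    by (unfold r; now rewrite INR_IZR_INZ, Z2Nat.id by lia).
  apply (f_equal IZR) in D; rewrite plus_IZR, mult_IZR in D.
  assert (E : eq_mod1 (y + INR r / 5) x).
  { exists (- (k / 5))%Z; rewrite opp_IZR; lra. }
  destruct (Z.eq_dec (k mod 5) 0) as [Z0|Z0].
  - apply N; revert E; apply eq_mod1_opp; rewrite Er, Z0; lra.
  - revert E; apply hT; trivial; unfold r; lia.
Qed.

(** Translating [w0] to 0 sends the other points to the three remaining multiples of a quarter in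
    some order. *)
Lemma square_congruent w0 w1 w2 w3 :
  ~ eq_mod1 w0 w1 -> ~ eq_mod1 w0 w2 -> ~ eq_mod1 w0 w3 ->
  ~ eq_mod1 w1 w2 -> ~ eq_mod1 w1 w3 -> ~ eq_mod1 w2 w3 ->
  eq_mod1 (4 * (w1 - w0)) 0 -> eq_mod1 (4 * (w2 - w0)) 0 -> eq_mod1 (4 * (w3 - w0)) 0 ->
  congruent (fourset w0 w1 w2 w3) (fourset 0 (1/4) (1/2) (3/4)).
Proof.
  intros N01 N02 N03 N12 N13 N23 H1 H2 H3.
  assert (Q : forall y, eq_mod1 (4 * (y - w0)) 0 -> ~ eq_mod1 w0 y ->
            eq_mod1 y (w0 + 1/4) \/ eq_mod1 y (w0 + 1/2) \/ eq_mod1 y (w0 + 3/4)).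
  { intros y [k Hk] Ny.
    pose proof (Z.div_mod k 4 ltac:(lia)) as D.
    pose proof (Z.mod_pos_bound k 4 ltac:(lia)) as B.
    apply (f_equal IZR) in D; rewrite plus_IZR, mult_IZR in D.
    assert (k mod 4 = 0 \/ k mod 4 = 1 \/ k mod 4 = 2 \/ k mod 4 = 3)%Z
      as [E|[E|[E|E]]] by lia; rewrite E in D.
    - exfalso; apply Ny; exists (- (k / 4))%Z; rewrite opp_IZR; lra.
    - left; exists (k / 4)%Z; lra.
    - right; left; exists (k / 4)%Z; lra.
    - right; right; exists (k / 4)%Z; lra. }
  assert (J : forall x y z, eq_mod1 x z -> eq_mod1 y z -> eq_mod1 x y).
  { intros x y z [k1 K1] [k2 K2]; exists (k1 - k2)%Z; rewrite minus_IZR; lra. }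
  exists (Transl (- w0)); intros x; simpl; unfold fourset.
  assert (S : forall q y, eq_mod1 y (w0 + q) ->
            (eq_mod1 x q <-> eq_mod1 (x + w0) y)).
  { intros q y [k K]; split; intros [l L'].
    - exists (l - k)%Z; rewrite minus_IZR; lra.
    - exists (l + k)%Z; rewrite plus_IZR; lra. }
  transitivity (eq_mod1 (x + w0) w0 \/ eq_mod1 (x + w0) w1 \/
                eq_mod1 (x + w0) w2 \/ eq_mod1 (x + w0) w3).
  - assert (S0 : eq_mod1 x 0 <-> eq_mod1 (x + w0) w0)
      by (apply S; exists 0%Z; lra).
    rewrite S0; clear S0.
    (* Of 27 assignments only the six bijective ones survive; in the others two points coincide by
       [J]. *)
    destruct (Q w1 H1 N01) as [E1|[E1|E1]], (Q w2 H2 N02) as [E2|[E2|E2]],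
      (Q w3 H3 N03) as [E3|[E3|E3]];
      try (exfalso; eauto; fail);
      rewrite (S _ _ E1), (S _ _ E2), (S _ _ E3); tauto.
  - split.
    + intros H; exists (x + w0); split; trivial. exists 0%Z; lra.
    + intros (y & Hy & E).
      assert (E' : eq_mod1 (x + w0) y) by (revert E; apply eq_mod1_shift; lra).
      destruct Hy as [Hy|[Hy|[Hy|Hy]]]; pose proof (eq_mod1_trans _ _ _ E' Hy); tauto.
Qed.

Theorem theorem2p4p1 (w0 w1 w2 w3 : R)
  (hdist : ~ eq_mod1 w0 w1 /\ ~ eq_mod1 w0 w2 /\ ~ eq_mod1 w0 w3 /\
           ~ eq_mod1 w1 w2 /\ ~ eq_mod1 w1 w3 /\ ~ eq_mod1 w2 w3)
  (hT : forall i : nat, (1 <= i <= 4)%nat ->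
        forall x y, fourset w0 w1 w2 w3 x -> fourset w0 w1 w2 w3 y ->
        ~ eq_mod1 (x + INR i / 5)%R y) :
  P (fourset w0 w1 w2 w3) \/
  congruent (fourset w0 w1 w2 w3) (fourset 0 (1/4) (1/2) (3/4)).
Proof.
  destruct hdist as (N01 & N02 & N03 & N12 & N13 & N23).
  apply NNPP; intros NP; apply not_or_and in NP as [NP NC].
  (* A scalene triple inside the set would already give [P]. *)
  assert (S : forall a b c, fourset w0 w1 w2 w3 a -> fourset w0 w1 w2 w3 b ->
            fourset w0 w1 w2 w3 c -> ~ scalene a b c).
  { intros a b c Ha Hb Hc Hs; apply NP, (P_of_scalene _ a b c Hs).
    intros x Hx; unfold fourset in *.
    destruct Hx as [Hx|[Hx|Hx]];
      [destruct Ha as [H|[H|[H|H]]]|destruct Hb as [H|[H|[H|H]]]|destruct Hc as [H|[H|[H|H]]]];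
      pose proof (eq_mod1_trans _ _ _ Hx H); tauto. }
  assert (M0 : fourset w0 w1 w2 w3 w0) by (left; apply eq_mod1_refl).
  assert (M1 : fourset w0 w1 w2 w3 w1) by (right; left; apply eq_mod1_refl).
  assert (M2 : fourset w0 w1 w2 w3 w2) by (do 2 right; left; apply eq_mod1_refl).
  assert (M3 : fourset w0 w1 w2 w3 w3) by (do 3 right; apply eq_mod1_refl).
  apply (refutable_sound [w0; w1; w2; w3] _ _ _ _ isosceles_refuted).
  - repeat constructor; simpl fst; simpl snd; rewrite holds_multiple; apply ceq_false;
      now apply (fifths w0 w1 w2 w3).
  - constructor; [|constructor].
    repeat (constructor; [apply isosceles_clause_ok; simpl; trivial; now apply S|]).
    constructor; [|constructor].
    unfold clause_ok; simpl; rewrite !holds_multiple, !andb_true_iff, !ceqP; simpl.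
    intros (H1 & H2 & H3 & _); exfalso; apply NC; now apply square_congruent.
Qed.
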